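(* Let $n \ge 6$ be an integer. For any graph $G \in \mathcal{U}_{n,2}$, we have $\rho(G) \ge \rho\left(G_1\left(\lfloor \frac{n-4}{2} \rfloor, \lceil \frac{n-4}{2} \rceil\right)\right)$, and equality holds if and only if $G \cong G_1\left(\left\lfloor \frac{n-4}{2} \right\rfloor, \left\lceil \frac{n-4}{2} \right\rceil\right)$.
   Context: All graphs are finite and simple. $\rho(G)$ denotes the spectral radius of $G$, i.e. the maximum absolute value of an eigenvalue of its adjacency matrix. A unicyclic graph is a connected graph containing exactly one cycle. The matching number $\gamma(G)$ is the maximum number of pairwise disjoint edges of $G$. $\mathcal{U}_{n,\gamma}$ is the class of all connected unicyclic graphs on $n$ vertices with matching number $\gamma$. A pendant vertex is a vertex of degree one; ''attaching $m$ pendant vertices to a vertex $v$'' means adding $m$ new vertices, each adjacent only to $v$. For nonnegative integers $a,b$, $G_1(a,b)$ is the graph obtained from the $4$-cycle $[v_1,v_2,v_3,v_4,v_1]$ by attaching $a$ pendant vertices to $v_2$ and $b$ pendant vertices to $v_4$. $\cong$ denotes graph isomorphism. *)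

(* Defs.v *)
From HB Require Import structures.
From mathcomp Require Import all_boot all_order all_algebra.
From mathcomp Require Import classical_sets reals complex.
Set Implicit Arguments.
Unset Strict Implicit.
Unset Printing Implicit Defensive.
Import GRing.Theory Num.Theory.

Record sgraph := SGraph {
  vertex :> finType;
  adj : rel vertex;
  adj_sym : symmetric adj;
  adj_irr : irreflexive adj }.

Definition edges (G : sgraph) : {set {set G}} :=
  [set [set p.1; p.2] | p : G * G & adj p.1 p.2].

Definition isomorphic (G H : sgraph) : Prop :=
  exists2 f : G -> H, bijective f & forall x y, adj (f x) (f y) = adj x y.

Definition connected (G : sgraph) : Prop :=
  forall x y : G, connect (@adj G) x y.

(* A cycle is a subgraph, so it is identified with its set of edges: the
   sequences of vertices that run through it in different directions, or from
   different starting points, count as one cycle. *)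
Definition is_cycle (G : sgraph) (C : {set {set G}}) : Prop :=
  exists p : seq G, [/\ 2 < size p, ucycle (@adj G) p
                      & C = [set [set x; next p x] | x in p]].

Definition unicyclic (G : sgraph) : Prop :=
  connected G /\ exists! C : {set {set G}}, is_cycle C.

Definition is_matching (G : sgraph) (M : {set {set G}}) : bool :=
  (M \subset edges G) && finset.trivIset M.

Definition matching_number (G : sgraph) : nat :=
  \max_(M : {set {set G}} | is_matching M) #|M|.

Definition unicyclic_class (n k : nat) (G : sgraph) : Prop :=
  [/\ unicyclic G, #|G| = n & matching_number G = k].

Definition adj_mx (F : fieldType) (G : sgraph) : 'M[F]_#|G| :=
  (\matrix_(i, j) (adj (enum_val i) (enum_val j))%:R)%R.

(* All complex eigenvalues are considered. There are finitely many of them, and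
   at least one when G has a vertex, so that the supremum is a maximum. *)
Definition spectral_radius (R : realType) (G : sgraph) : R :=
  sup [set Normc.normc z | z in [set z : R[i] | eigenvalue (adj_mx R[i] G) z]]%classic.

Section AttachPendants.
Variables (G : sgraph) (v : G) (m : nat).

Definition attach_adj : rel (G + 'I_m) := fun x y =>
  match x, y with
  | inl u, inl w => adj u w
  | inl u, inr _ => u == v
  | inr _, inl w => w == v
  | inr _, inr _ => false
  end.

Fact attach_sym : symmetric attach_adj.
Proof. by case=> [u|i] [w|j] //=; exact: adj_sym. Qed.

Fact attach_irr : irreflexive attach_adj.
Proof. by case=> [u|i] //=; exact: adj_irr. Qed.

Definition attach_pendants : sgraph := SGraph attach_sym attach_irr.

End AttachPendants.

Definition C4_adj : rel 'I_4 := fun i j => (j == ordS i) || (i == ordS j).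

Fact C4_sym : symmetric C4_adj.
Proof. by move=> i j; rewrite /C4_adj orbC. Qed.

Fact C4_irr : irreflexive C4_adj.
Proof. by move=> i; rewrite /C4_adj orbb; case: i => -[|[|[|[|]]]]. Qed.

Definition C4 : sgraph := SGraph C4_sym C4_irr.

(* The vertices v_1, ..., v_4 of the 4-cycle are 0, ..., 3 in 'I_4. *)
Definition C4_v2 : C4 := @Ordinal 4 1 isT.
Definition C4_v4 : C4 := @Ordinal 4 3 isT.

Definition G1 (a b : nat) : sgraph :=
  @attach_pendants (attach_pendants C4_v2 a) (inl C4_v4) b.

(* Main.v *)
(* As n >= 6, a cycle of length at least 5 would give three disjoint edges, so G is a
   4-cycle with pendant vertices at two opposite vertices, a triangle with
   pendant vertices at two of its vertices, or a triangle joined by an edge to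
   the centre of a star.  A positive eigenfunction shows
   2 rho(G_1(a,b))^2 = a + b + 4 + sqrt((a-b)^2 + 16), which, a + b being fixed,
   is least for the balanced graph.  For the two triangle families an explicit
   test vector has Rayleigh quotient larger than the balanced radius. *)
Require Import Defs.
From mathcomp Require Import all_boot all_order all_algebra.
From mathcomp Require Import reals.
From mathcomp Require classical_sets complex spectral.
From mathcomp Require Import ring lra zify.
Set Implicit Arguments.
Unset Strict Implicit.
Unset Printing Implicit Defensive.
Import Order.TTheory.

(** * Spectral radius: positive eigenfunctions and Rayleigh quotients *)

Section SpectralRadius.
Import GRing.Theory Num.Theory.
Import classical_sets complex spectral.
Local Open Scope ring_scope.
Local Open Scope complex_scope.
Local Open Scope sesquilinear_scope.

Lemma sum_adj_mx (F : fieldType) (G : sgraph) (f : 'I_#|G| -> F) (j : 'I_#|G|) :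
  \sum_i f i * adj_mx F G i j = \sum_(v : G | adj v (enum_val j)) f (enum_rank v).
Proof.
rewrite (reindex (@enum_rank G)) /=; last by apply/onW_bij/enum_rank_bij.
rewrite [RHS]big_mkcond /=; apply: eq_bigr => v _.
by rewrite mxE enum_rankK mulr_natr mulrb.
Qed.

Lemma adj_eigenvalueP (F : fieldType) (G : sgraph) (z : F) :
  eigenvalue (adj_mx F G) z <->
  exists2 y : G -> F, exists v, y v != 0
    & forall w, \sum_(v | adj v w) y v = z * y w.
Proof.
split=> [/eigenvalueP[u uA u0]|[y [v yv0] yA]].
  exists (fun v => u 0 (enum_rank v)) => [|w].
    by have /rV0Pn[i ui0] := u0; exists (enum_val i); rewrite enum_valK.
  have := congr1 (fun x : 'rV_#|G| => x 0 (enum_rank w)) uA.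
  by rewrite !mxE sum_adj_mx enum_rankK.
apply/eigenvalueP; exists (\row_i y (enum_val i)).
  apply/rowP => j; rewrite !mxE sum_adj_mx -yA.
  by apply: eq_bigr => w _; rewrite mxE enum_rankK.
by apply/rV0Pn; exists (enum_rank v); rewrite mxE enum_rankK.
Qed.

Variables (R : realType) (G : sgraph).

(* Pair the entrywise inequality [|z| |y| <= A |y|] with [x], where [y] is an
   eigenvector for [z]. *)
Lemma normc_eigenvalue_le (x : G -> R) (l : R) (z : R[i]) :
  (forall v, 0 < x v) -> (forall v, \sum_(w | adj v w) x w <= l * x v) ->
  eigenvalue (adj_mx R[i] G) z -> Normc.normc z <= l.
Proof.
move=> x0 xA /adj_eigenvalueP[y [v0 yv0] yA].
pose N v := Normc.normc (y v).
have N0 v : 0 <= N v by rewrite /N; case: (y v) => a b; exact: sqrtr_ge0.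
have Nv0 : 0 < N v0.
  by rewrite lt_neqAle N0 andbT eq_sym; apply: contra yv0 => /eqP/Normc.eq0_normc->.
have NA w : Normc.normc z * N w <= \sum_(v | adj v w) N v.
  rewrite /N -Normc.normcM -yA.
  elim/big_rec2: _ => [|v a b _ ab]; first by rewrite Normc.normc0.
  exact: le_trans (le_normcD _ _) (lerD (lexx _) ab).
have S0 : 0 < \sum_w x w * N w.
  rewrite (bigD1 v0) //=; apply: ltr_wpDr; last by rewrite mulr_gt0.
  by apply: sumr_ge0 => w _; rewrite mulr_ge0 // ltW.
rewrite -(ler_pM2r S0) mulr_sumr mulr_sumr.
apply: (@le_trans _ _ (\sum_w \sum_(v | adj v w) x w * N v)).
  apply: ler_sum => w _; rewrite -mulr_sumr mulrCA.
  by rewrite ler_pM2l.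
(* Exchanging the sums moves the adjacency operator from [N] to [x]. *)
rewrite (exchange_big_dep predT) //=; apply: ler_sum => v _.
by rewrite -mulr_suml mulrA ler_wpM2r.
Qed.

Let moduli := [set Normc.normc z | z in [set z : R[i] | eigenvalue (adj_mx R[i] G) z]]%classic.

(** [sup] bounds a set only if the set is bounded above; the constant function 1 bounds all moduli
    by the order of the graph. *)
Lemma eigenvalue_le_spectral_radius (z : R[i]) :
  eigenvalue (adj_mx R[i] G) z -> Normc.normc z <= spectral_radius R G.
Proof.
move=> ez; apply: (@ub_le_sup _ moduli); last by exists z.
exists #|G|%:R => _ [t et <-].
apply: (@normc_eigenvalue_le (fun=> 1)) et => // v.
by rewrite sumr_const mulr1 ler_nat max_card.
Qed.

(** The number [l] is itself an eigenvalue, and the positive [x] bounds every modulus by [l]. The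
    vertex [v0] makes [l] nonnegative and the eigenvector nonzero. *)
Lemma spectral_radius_positive_eigenfunction (x : G -> R) (l : R) (v0 : G) :
  (forall v, 0 < x v) -> (forall v, \sum_(w | adj v w) x w = l * x v) ->
  spectral_radius R G = l.
Proof.
move=> x0 xA.
have l0 : 0 <= l.
  rewrite -(pmulr_lge0 _ (x0 v0)) -xA.
  by apply: sumr_ge0 => w _; exact: ltW.
have el : eigenvalue (adj_mx R[i] G) l%:C.
  apply/adj_eigenvalueP; exists (fun v => (x v)%:C) => [|w].
    by exists v0; rewrite (fmorph_eq0 (real_complex R)) gt_eqF.
  rewrite -rmorphM -xA rmorph_sum /=.
  by apply: eq_bigl => v; rewrite adj_sym.
have nl : Normc.normc l%:C = l by rewrite /= expr0n /= addr0 sqrtr_sqr ger0_norm.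
apply/eqP; rewrite eq_le; apply/andP; split.
  apply: (@ge_sup _ moduli); first by exists l; exists l%:C.
  move=> _ [z ez <-]; apply: normc_eigenvalue_le ez => // v.
  by rewrite xA.
by rewrite -[X in X <= _]nl; exact: eigenvalue_le_spectral_radius.
Qed.

(** The adjacency matrix is real symmetric, hence unitarily diagonalisable. In the coordinates [Y]
    the form is the sum of [d_i |Y_i|^2], and every [|d_i|] is at most the spectral radius. *)
Lemma rayleigh_le_spectral_radius (x : G -> R) :
  \sum_v \sum_(w | adj v w) x v * x w <= spectral_radius R G * \sum_v x v ^+ 2.
Proof.
pose A := adj_mx R[i] G.
have AT : A^T = A by apply/matrixP => i j; rewrite !mxE adj_sym.
have AC : A ^ Num.conj = A by apply/matrixP => i j; rewrite !mxE conjC_nat.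
have /orthomx_spectralP Asp : A \is normalmx by apply/normalmxP; rewrite AT AC.
have Pu := spectral_unitarymx A; set P := spectralmx A in Asp Pu.
set d := spectral_diag A in Asp.
have nd i : `|d 0 i| <= (spectral_radius R G)%:C.
  have -> : `|d 0 i| = (Normc.normc (d 0 i))%:C by [].
  rewrite lecR; apply: eigenvalue_le_spectral_radius.
  apply/eigenvalueP; exists (row i P).
    rewrite -[adj_mx _ _]/A -row_mul Asp !mulmxA mulmxV ?unitarymx_unit // mul1mx.
    by rewrite row_mul row_diag_mx -scalemxAl -rowE.
  (* A zero row of [P], multiplied by the adjoint of [P], would give a zero row of the identity. *)
  apply/eqP => /(congr1 (fun r => (r *m P ^t*) )).
  rewrite -row_mul (unitarymxP Pu) mul0mx => /rowP/(_ i)/eqP.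
  by rewrite !mxE eqxx oner_eq0.
pose X := \row_i (x (enum_val i))%:C : 'rV[R[i]]_#|G|.
have XC : X ^t* = X^T by apply/matrixP => i j; rewrite !mxE; exact: conjc_real.
pose Y := X *m P ^t*.
have YC : Y ^t* = P *m X^T by rewrite /Y trmx_mul map_mxM XC trmxCK.
have eA : X *m A *m X^T = Y *m diag_mx d *m Y ^t*.
  by rewrite YC Asp invmx_unitary // !mulmxA.
have eX : X *m X^T = Y *m Y ^t*.
  by rewrite YC mulmxA mulmxKtV.
have qA : (X *m A *m X^T) 0 0 = (\sum_v \sum_(w | adj v w) x v * x w)%:C.
  rewrite mxE rmorph_sum (reindex (@enum_rank G)) /=; last by apply/onW_bij/enum_rank_bij.
  apply: eq_bigr => v _; rewrite !mxE sum_adj_mx enum_rankK rmorph_sum mulr_suml.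
  apply: eq_big => [w|w _]; first by rewrite adj_sym.
  by rewrite mxE enum_rankK -rmorphM mulrC.
have qX : (X *m X^T) 0 0 = (\sum_v x v ^+ 2)%:C.
  rewrite mxE rmorph_sum (reindex (@enum_rank G)) /=; last by apply/onW_bij/enum_rank_bij.
  by apply: eq_bigr => v _; rewrite !mxE enum_rankK -rmorphM.
rewrite -lecR rmorphM /= -qX -qA eX eA.
apply: le_trans (real_ler_norm _) _; first by rewrite -eA qA; apply/complex_realP; eexists.
rewrite mxE [X in _ * X]mxE mulr_sumr.
apply: le_trans (ler_norm_sum _ _ _) _; apply: ler_sum => i _.
rewrite mul_mx_diag !mxE normrM normrM norm_conjC mulrAC mulrC.
by rewrite -expr2 normCK ler_wpM2r ?mul_conjC_ge0.
Qed.
End SpectralRadius.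

(** * Radius of G_1(a,b) and a lower bound from test vectors *)

Section Comparison.
Import GRing.Theory Num.Theory.
Local Open Scope ring_scope.
Variable R : realType.

(** With [p = l^2 - a] and [q = l^2 - b], the positive eigenfunction is 1/p at v_2, 1/q at v_4,
    1/(2l) at v_1 and v_3, and the value of the centre over [l] at a pendant vertex. Only the
    equations at v_1 and v_3 constrain [l]: they read 1/p + 1/q = 1/2, which is the last
    hypothesis. *)
Lemma spectral_radius_isomorphic_G1 (G : sgraph) (a b : nat) (l : R) :
  isomorphic G (G1 a b) -> 0 < l -> a%:R < l ^+ 2 -> b%:R < l ^+ 2 ->
  (l ^+ 2 - a%:R) * (l ^+ 2 - b%:R) = 2 * (l ^+ 2 - a%:R) + 2 * (l ^+ 2 - b%:R) ->
  spectral_radius R G = l.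
Proof.
move=> [f fbij fadj] l0 al bl lP.
set p := l ^+ 2 - a%:R in lP; set q := l ^+ 2 - b%:R in lP.
have p0 : 0 < p by rewrite subr_gt0.
have q0 : 0 < q by rewrite subr_gt0.
pose y (v : G1 a b) : R := match v with
  | inl (inl i) => if i == C4_v2 then p^-1 else if i == C4_v4 then q^-1 else (2 * l)^-1
  | inl (inr _) => (p * l)^-1
  | inr _ => (q * l)^-1
  end.
have y0 v : 0 < y v.
  by case: v => [[i|i]|i] /=; do ?case: ifP => _; rewrite invr_gt0 ?mulr_gt0.
have pq : p^-1 + q^-1 = 2^-1.
  apply: (@mulfI _ (2 * (p * q))); first by rewrite !mulf_neq0 ?gt_eqF.
  rewrite mulrDr.
  have -> : 2 * (p * q) / p = 2 * q by field; rewrite gt_eqF.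
  have -> : 2 * (p * q) / q = 2 * p by field; rewrite gt_eqF.
  by rewrite lP; lra.
have ea : a%:R = l ^+ 2 - p by rewrite /p; ring.
have eb : b%:R = l ^+ 2 - q by rewrite /q; ring.
have yA v : \sum_(w | adj v w) y w = l * y v.
  rewrite big_mkcond big_sumType big_sumType /= !big_ord_recl big_ord0 /=.
  case: v => [[[[|[|[|[|//]]]] hi]|i]|i] /=;
    rewrite ?sumr_const ?card_ord ?big1_eq ?mul0rn !(addr0, add0r).
  - by rewrite pq; field; rewrite gt_eqF.
  - by rewrite -[_ *+ a]mulr_natl ea; field; rewrite !gt_eqF.
  - by rewrite pq; field; rewrite gt_eqF.
  - by rewrite -[_ *+ b]mulr_natl eb; field; rewrite !gt_eqF.
  - by field; rewrite !gt_eqF.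
  - by field; rewrite !gt_eqF.
have [g fK gK] := fbij.
apply: (@spectral_radius_positive_eigenfunction _ _ (y \o f) _ (g (inl (inl C4_v2)))) => [v|v] /=.
  exact: y0.
rewrite -yA [RHS](reindex f) /=; last exact: onW_bij.
by apply: eq_bigl => w; exact: esym (fadj v w).
Qed.

(** Square root of the larger root t of (t - a)(t - b) = 2(t - a) + 2(t - b), whose discriminant is
    (a - b)^2 + 16. *)
Definition G1_radius (a b : nat) : R :=
  Num.sqrt ((a%:R + b%:R + 4 + Num.sqrt ((a%:R - b%:R) ^+ 2 + 16)) / 2).

Lemma spectral_radius_G1 (G : sgraph) (a b : nat) :
  isomorphic G (G1 a b) -> spectral_radius R G = G1_radius a b.
Proof.
move=> iso; set u : R := (a%:R - b%:R) ^+ 2 + 16.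
have u0 : 0 <= u by rewrite addr_ge0 ?sqr_ge0.
have s2 : Num.sqrt u ^+ 2 = u by rewrite sqr_sqrtr.
have s0 : 0 <= Num.sqrt u by exact: sqrtr_ge0.
have a0 : 0 <= a%:R :> R by exact: ler0n.
have b0 : 0 <= b%:R :> R by exact: ler0n.
have l2 : G1_radius a b ^+ 2 = (a%:R + b%:R + 4 + Num.sqrt u) / 2.
  by rewrite sqr_sqrtr // divr_ge0 // !addr_ge0.
(* Hence the larger root is at least max(a,b) + 2, so that the eigenfunction is positive. *)
have [rab rba] : a%:R - b%:R <= Num.sqrt u /\ b%:R - a%:R <= Num.sqrt u.
  have : `|a%:R - b%:R| <= Num.sqrt u by rewrite -sqrtr_sqr ler_wsqrtr // lerDl.
  by rewrite ler_norml => /andP[? ?]; split; lra.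
rewrite /u in s2; move: (Num.sqrt u) s2 s0 l2 rab rba => r s2 s0 l2 rab rba.
apply: spectral_radius_isomorphic_G1 iso _ _ _ _; rewrite ?l2; [|lra|lra|].
  rewrite lt_neqAle sqrtr_ge0 andbT eq_sym; apply/eqP => l_eq0.
  by move: l2; rewrite l_eq0 expr0n /=; lra.
nra.
Qed.

(** For a fixed sum the radius increases with the gap, and b - a > d - c. *)
Lemma G1_radius_lt (a b c d : nat) : (a + b = c + d)%N -> (a <= b)%N -> (c <= d)%N ->
  (a < c)%N -> G1_radius c d < G1_radius a b.
Proof.
move=> e ab cd ac.
rewrite ltr_sqrt; last first.
  by rewrite divr_gt0 // -!natrD ltr_pwDl ?ltr0n ?addnS // sqrtr_ge0.
rewrite ltr_pM2r ?invr_gt0 // -!natrD e ltrD2l.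
rewrite ltr_sqrt; last by rewrite ltr_pwDr ?sqr_ge0.
(* Changing signs turns the differences into b - a and d - c, which do not truncate in [nat]. *)
rewrite ltrD2r -(sqrrN (_ - b%:R)) -(sqrrN (_ - d%:R)) !opprB -!natrB //.
by rewrite -!natrX ltr_nat ltn_sqr; lia.
Qed.

(** Here [r] is 4 for even [m] and the square root of 17 for odd [m]; the rational bound 33/8 on the
    latter suffices for the comparisons with the triangle families. *)
Lemma balanced_G1_radius (m : nat) (m2 : (2 <= m)%N) : exists2 r : R,
  r = 4 \/ 3 <= m%:R :> R /\ 4 <= r <= 33 / 8 &
  2 * G1_radius m./2 (uphalf m) ^+ 2 = m%:R + 4 + r.
Proof.
have sum_m : m./2%:R + (uphalf m)%:R = m%:R :> R.
  by rewrite -natrD uphalf_half addnCA addnn odd_double_half.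
have diff_m : (m./2%:R - (uphalf m)%:R) ^+ 2 = (odd m)%:R :> R.
  by rewrite uphalf_half natrD opprD addrCA subrr addr0 sqrrN -natrX; case: odd.
exists (Num.sqrt ((odd m)%:R + 16)); last first.
  rewrite sqr_sqrtr ?diff_m ?sum_m; first by field.
  by rewrite divr_ge0 ?addr_ge0 ?sqrtr_ge0.
case: (boolP (odd m)) => om; last first.
  left; rewrite add0r -[16%:R](_ : 4 ^+ 2 = _) ?sqrtr_sqr ?ger0_norm //; ring.
right; split; first by rewrite ler_nat; move: m2 om; case: (m) => [|[|[|]]].
have r2 : Num.sqrt (1 + 16 : R) ^+ 2 = 1 + 16 by rewrite sqr_sqrtr ?addr_ge0.
move: r2 (sqrtr_ge0 (1 + 16 : R)); move: (Num.sqrt _) => r r2 r0.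
by apply/andP; split; nra.
Qed.

(* Rayleigh quotient of [x] extended by [1 / l] outside [s]; the hypothesis makes
   every outside vertex contribute at least [2 / l - 1 / l]. *)
Lemma spectral_radius_gt (G : sgraph) (s : seq G) (x : G -> R) (l : R) :
  uniq s -> 0 < l -> {in s, forall v, 0 <= x v} ->
  (forall v, v \notin s -> 1 <= \sum_(w <- s | adj v w) x w) ->
  l * \sum_(v <- s) x v ^+ 2 <
    \sum_(v <- s) \sum_(w <- s | adj v w) x v * x w + (#|G| - size s)%:R / l ->
  l < spectral_radius R G.
Proof.
move=> us l0 x0 xs hl.
pose y v := if v \in s then x v else l^-1.
have y0 v : 0 <= y v by rewrite /y; case: ifPn => [/x0//|_]; rewrite invr_ge0 ltW.
have sum2 : \sum_v y v ^+ 2 = \sum_(v <- s) x v ^+ 2 + (#|G| - size s)%:R / l ^+ 2.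
  rewrite (bigID (mem s)) /= -big_uniq //; congr (_ + _).
    by apply: eq_big_seq => v vs; rewrite /y vs.
  rewrite (eq_bigr (fun=> l ^- 2)) => [|v /negPf vs]; last by rewrite /y vs exprVn.
  by rewrite sumr_const -(cardC (mem s)) (card_uniqP us) addKn mulr_natl.
have sumA : \sum_(v <- s) \sum_(w <- s | adj v w) x v * x w +
    2 * ((#|G| - size s)%:R / l) <= \sum_v \sum_(w | adj v w) y v * y w.
  pose F v w := if adj v w then y v * y w else 0.
  have F0 v w : 0 <= F v w by rewrite /F; case: ifP => // _; rewrite mulr_ge0.
  have -> : \sum_v \sum_(w | adj v w) y v * y w = \sum_v \sum_w F v w.
    by apply: eq_bigr => v _; rewrite big_mkcond.
  have -> : \sum_(v <- s) \sum_(w <- s | adj v w) x v * x w =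
      \sum_(v in s) \sum_(w in s) F v w.
    rewrite -big_uniq //; apply: eq_big_seq => v vs; rewrite -big_uniq // big_mkcond.
    by apply: eq_big_seq => w ws; rewrite /F /y vs ws.
  have outer : (#|G| - size s)%:R / l <= \sum_(v | v \notin s) \sum_(w in s) F v w.
    rewrite -(card_uniqP us) -(cardC (mem s)) addKn mulr_natl -sumr_const.
    apply: ler_sum => v vs; have vs' : v \notin s by [].
    apply: le_trans (_ : l^-1 * \sum_(w <- s | adj v w) x w <= _).
      by rewrite ler_peMr ?xs // invr_ge0 ltW.
    rewrite -big_uniq // big_mkcond mulr_sumr (eq_big_seq (F v)) // => w ws.
    by rewrite /F /y ws (negPf vs'); case: ifP; rewrite ?mulr0.
  (* Four blocks: inside [s], two cross blocks, equal by symmetry, and outside [s]. The last is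
     nonnegative and is dropped. *)
  have -> : \sum_v \sum_w F v w = \sum_(v in s) \sum_(w in s) F v w
      + (\sum_(v in s) \sum_(w | w \notin s) F v w
      + \sum_(v | v \notin s) \sum_(w in s) F v w)
      + \sum_(v | v \notin s) \sum_(w | w \notin s) F v w.
    rewrite (bigID (mem s)) /= !addrA -[RHS]addrA -!big_split /=.
    by congr (_ + _); apply: eq_bigr => v _; rewrite (bigID (mem s)).
  have -> : \sum_(v in s) \sum_(w | w \notin s) F v w =
      \sum_(v | v \notin s) \sum_(w in s) F v w.
    rewrite exchange_big; apply: eq_bigr => v _; apply: eq_bigr => w _.
    by rewrite /F adj_sym mulrC.
  rewrite -addrA lerD2l mulr2n mulrDl !mul1r; apply: ler_wpDr; last exact: lerD.
  by apply: sumr_ge0 => v _; apply: sumr_ge0 => w _.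
rewrite ltNge; apply/negP => rl.
have T0 : 0 <= \sum_v y v ^+ 2 by apply: sumr_ge0 => v _; exact: sqr_ge0.
have := le_trans (le_trans sumA (@rayleigh_le_spectral_radius R G y)) (ler_wpM2r T0 rl).
have e : l * ((#|G| - size s)%:R / l ^+ 2) = (#|G| - size s)%:R / l.
  by field; rewrite gt_eqF.
by rewrite sum2 mulrDr e; lra.
Qed.

(** * The two triangle families against the balanced graph *)

Lemma G1_radius_gt0 (a b : nat) : 0 < G1_radius a b.
Proof.
rewrite sqrtr_gt0 divr_gt0 // ltr_wpDr ?sqrtr_ge0 //.
by rewrite ltr_wpDl // -natrD.
Qed.

(** The test vector is 1 at [a] and [b], and solves the eigenvalue equation for [l] at [c], which
    gives 2/l there. *)
Lemma triangle_pendants_radius (G : sgraph) (m : nat) (a b c : G) :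
  #|G| = (m + 4)%N -> (2 <= m)%N -> adj a b -> adj b c -> adj a c ->
  (forall v, v \notin [:: a; b; c] -> adj v a || adj v b) ->
  G1_radius m./2 (uphalf m) < spectral_radius R G.
Proof.
move=> nG m2 ab bc ac pend.
have [na nb nc] : [/\ a != b, b != c & a != c].
  by split; [move: ab|move: bc|move: ac]; apply: contraTneq => ->; rewrite adj_irr.
have [r hr l2] := balanced_G1_radius m2; have l0 := G1_radius_gt0 m./2 (uphalf m).
move: (G1_radius _ _) l2 l0 => l l2 l0.
pose x v : R := if v == c then 2 / l else 1.
have [xa xb xc] : [/\ x a = 1, x b = 1 & x c = 2 / l].
  by rewrite /x eqxx (negPf nb) (negPf nc).
have xge v : 0 <= x v by rewrite /x; case: ifP => // _; rewrite divr_ge0 // ltW.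
apply: (@spectral_radius_gt _ [:: a; b; c] x) => //.
- by rewrite /= !inE negb_or na nb nc.
- move=> v /pend; rewrite !big_cons big_nil xa xb addr0.
  by case: (adj v a); case: (adj v b); case: (adj v c) => //=; have := xge c; lra.
rewrite !big_cons !big_nil !adj_irr ab ac bc !(adj_sym b a) !(adj_sym c) ab bc ac xa xb xc /=.
rewrite nG (_ : m + 4 - 3 = m.+1)%N; last by lia.
rewrite -natr1.
(* As 2 l^2 = m + 4 + r, the numerator is 1 + 2l - r, positive because l >= 2 and r <= 33/8. *)
rewrite -subr_gt0 [X in 0 < X](_ : _ = (m%:R + 5 + 2 * l - 2 * l ^+ 2) / l).
  have m2R : 2 <= m%:R :> R by rewrite ler_nat.
  have rb : 4 <= r <= 33 / 8 by case: hr => [->|[]//]; apply/andP; split; lra.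
  have l_ge2 : 2 <= l by nra.
  by rewrite divr_gt0 // l2; lra.
by field; rewrite gt_eqF.
Qed.

Lemma triangle_broom_radius (G : sgraph) (m : nat) (a b c u : G) :
  #|G| = (m + 4)%N -> (2 <= m)%N -> adj a b -> adj b c -> adj a c -> adj u a ->
  uniq [:: u; a; b; c] ->
  (forall v, v \notin [:: u; a; b; c] -> adj v u) ->
  G1_radius m./2 (uphalf m) < spectral_radius R G.
Proof.
move=> nG m2 ab bc ac ua us pend.
have := us; rewrite /= !inE !negb_or => /and4P[/and3P[nua nub nuc] /andP[nab nac] nbc _].
have [r hr l2] := balanced_G1_radius m2; have l0 := G1_radius_gt0 m./2 (uphalf m).
move: (G1_radius _ _) l2 l0 => l l2 l0.
(* The test vector is 1 at [u], [p] at [a], and [q] at [b] and [c]. *)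
have main (p q : R) : 0 <= p -> 0 <= q ->
    l ^+ 2 * (1 + p ^+ 2 + 2 * q ^+ 2) < m%:R + l * (2 * p + 4 * p * q + 2 * q ^+ 2) ->
    l < spectral_radius R G.
  move=> p0 q0 pq.
  pose x v : R := if v == u then 1 else if v == a then p else q.
  have [xu xa xb xc] : [/\ x u = 1, x a = p, x b = q & x c = q].
    rewrite /x !eqxx (eq_sym a u) !(eq_sym b) !(eq_sym c).
    by rewrite (negPf nua) (negPf nub) (negPf nuc) (negPf nab) (negPf nac).
  have x0 v : 0 <= x v by rewrite /x; do 2?case: ifP.
  apply: (@spectral_radius_gt _ [:: u; a; b; c] x) => //.
    move=> v /pend vu; rewrite big_cons vu xu lerDl.
    by apply: sumr_ge0.
  rewrite !big_cons !big_nil !adj_irr !(adj_sym a u) !(adj_sym b) !(adj_sym c).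
  rewrite ab ac bc ua xu xa xb xc /=.
  rewrite nG addnK.
  (* Possible edges from [u] to [b] or [c] only add nonnegative terms. *)
  have uq v : 0 <= (if adj u v then q else 0) by case: ifP.
  rewrite -subr_gt0.
  pose e := (m%:R + l * (2 * p + 4 * p * q + 2 * q ^+ 2) - l ^+ 2 * (1 + p ^+ 2 + 2 * q ^+ 2)) / l.
  have e0 : 0 < e by rewrite divr_gt0 // subr_gt0.
  apply: lt_le_trans e0 _; rewrite -subr_ge0.
  rewrite [X in 0 <= X](_ : _ = 2 * (if adj u b then q else 0) + 2 * (if adj u c then q else 0)).
    by rewrite addr_ge0 // mulr_ge0.
  by rewrite /e; case: (adj u b); case: (adj u c) => /=; field; rewrite gt_eqF.
have m2R : 2 <= m%:R :> R by rewrite ler_nat.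
(* For large [l] the star alone suffices; for [l ^ 2 <= 9] the triangle must be
   weighted, by values close to those of the Perron vector. *)
have [t9|t9] := leP (l ^+ 2) 9; last first.
  (* The star at [u] has m + 1 edges, and the condition becomes l^2 < m + 1. *)
  apply: (main l^-1 0) => //; first by rewrite invr_ge0 ltW.
  rewrite expr0n /= !mulr0 !addr0 mulrDr mulr1 exprVn mulfV ?expf_neq0 ?gt_eqF //.
  rewrite mulrCA mulfV ?gt_eqF // mulr1.
  by case: hr => [|[]] *; lra.
(* After eliminating [m] the condition is 9 l^2 - 49 l + 32 + 8 r < 0. In both cases below, [l] is
   confined to an interval between the roots: m >= 2 gives l^2 >= 5 when r = 4, and m >= 3 gives l^2
   >= 11/2 otherwise. *)
apply: (main 1 (3 / 4)); [lra|lra|].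
have l_le : l <= 3 by nra.
have m_eq : m%:R = 2 * l ^+ 2 - 4 - r by lra.
rewrite m_eq; case: hr => [r4|[m3 /andP[r4 r_le]]].
  have l_ge : 11 / 5 <= l by nra.
  have : (l - 11 / 5) * (3 - l) >= 0 by rewrite mulr_ge0 ?subr_ge0.
  by rewrite r4; lra.
have l_ge : 117 / 50 <= l by nra.
have : (l - 23 / 10) * (31 / 10 - l) >= 0 by apply: mulr_ge0; lra.
by lra.
Qed.
End Comparison.

(** * Matchings, boundary edges and uniqueness of the cycle *)

Ltac distinct := rewrite ?cons_uniq /= ?inE ?negb_or;
  repeat (apply/andP; split); solve [done | by rewrite eq_sym | by rewrite adj_sym].

Lemma adj_neq (G : sgraph) (x y : G) : adj x y -> x != y.
Proof. by apply: contraTneq => ->; rewrite adj_irr. Qed.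

Lemma three_disjoint_edges (G : sgraph) (a b c d e f : G) :
  adj a b -> adj c d -> adj e f -> uniq [:: a; b; c; d; e; f] -> 2 < matching_number G.
Proof.
move=> ab cd ef; rewrite /= !inE !negb_or !andbT => /and5P[].
move=> /and5P[nab nac nad nae naf] /and4P[nbc nbd nbe nbf] /and3P[ncd nce ncf] /andP[nde ndf] nef.
have disj (x y z t : G) : x != z -> x != t -> y != z -> y != t ->
    [disjoint [set x; y] & [set z; t]].
  move=> xz xt yz yt; rewrite -setI_eq0; apply/eqP/setP => v; rewrite !inE.
  apply/negP => /andP[/orP[]/eqP->]; rewrite ?(negPf xz) ?(negPf xt) //.
  by rewrite (negPf yz) (negPf yt).
(* [trivIsetU1] asks that the empty set be absent, and in return shows that each added edge is
   new. *)
have n0 (x y : G) : [set x; y] != set0.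
  by apply/set0Pn; exists x; rewrite !inE eqxx.
have triv0 : finset.trivIset [set [set e; f]].
  by apply/trivIsetP => A B; rewrite !inE => /eqP-> /eqP->; rewrite eqxx.
have [||triv1 notin1] := trivIsetU1 _ triv0 (A := [set c; d]).
- by move=> B; rewrite !inE => /eqP->; apply: disj.
- by rewrite !inE eq_sym.
have [||triv2 notin2] := trivIsetU1 _ triv1 (A := [set a; b]).
- by move=> B; rewrite !inE => /orP[]/eqP->; apply: disj.
- by rewrite !inE negb_or !(eq_sym set0) !n0.
pose M := [set a; b] |: ([set c; d] |: [set [set e; f]]).
have cM : #|M| = 3 by rewrite !cardsU1 notin2 notin1 cards1.
rewrite -cM /matching_number; apply: (leq_bigmax_cond M).
rewrite /is_matching triv2 andbT; apply/subsetP => E; rewrite !inE.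
have edge (x y : G) : adj x y -> [set x; y] \in edges G.
  by move=> xy; apply/imsetP; exists (x, y); rewrite ?inE.
by case/or3P => /eqP->; apply: edge.
Qed.

Lemma connected_boundary (G : sgraph) (A : pred G) (x y : G) : connected G ->
  A x -> ~~ A y -> exists u v, [/\ A u, ~~ A v & adj u v].
Proof.
move=> /(_ x y)/connectP[p pp ->].
elim: p x pp => [x _ /= -> //|z p IHp x /= /andP[xz zp] Ax].
have [Az|nAz _] := boolP (A z); first exact: IHp.
by exists x, z.
Qed.

(** Both cycles have the same edge set, and each vertex of a cycle lies on one of its edges. *)
Lemma cycle_vertices_unique (G : sgraph) (p q : seq G) : unicyclic G ->
  2 < size p -> ucycle (@adj G) p -> 2 < size q -> ucycle (@adj G) q -> {subset p <= q}.
Proof.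
move=> [_ [C [_ Cuniq]]] sp up sq uq x xp.
have : [set x; next p x] \in [set [set x; next p x] | x in p] by apply/imsetP; exists x.
have <- : C = [set [set x; next p x] | x in p] by apply: Cuniq; exists p.
have -> : C = [set [set x; next q x] | x in q] by apply: Cuniq; exists q.
case/imsetP => y yq exy.
have : x \in [set y; next q y] by rewrite -exy !inE eqxx.
by rewrite !inE => /orP[]/eqP->; rewrite ?mem_next.
Qed.

(** * Recognising a 4-cycle with pendant vertices at two opposite vertices *)

Lemma isomorphic_inv (G H : sgraph) (h : H -> G) :
  bijective h -> (forall x y, adj (h x) (h y) = adj x y) -> isomorphic G H.
Proof.
move=> [f hK fK] hadj; exists f; first by exists h.
by move=> x y; rewrite -hadj !fK.
Qed.

(** The positions 0, ..., 3 go to [a], [b], [c], [d], and the pendant labels enumerate [B] and [D].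
    This map is injective between sets of equal size, hence bijective. *)
Lemma C4_pendants_isomorphic (G : sgraph) (a b c d : G) :
  let s := [:: a; b; c; d] in
  let B := [set v in [predC s] | adj v b] in let D := [set v in [predC s] | adj v d] in
  ucycle (@adj G) s -> ~~ adj a c -> ~~ adj b d ->
  (forall v, v \notin s -> [/\ ~~ adj v a, ~~ adj v c & adj v b = ~~ adj v d]) ->
  {in [predC s] &, forall v w, ~~ adj v w} ->
  isomorphic G (G1 #|B| #|D|) /\ #|B| + #|D| + 4 = #|G|.
Proof.
move=> s B D /andP[cs us] nac nbd outs indep.
have BD : B :&: D = set0.
  apply/setP => v; rewrite !inE; apply/negP => /andP[/andP[vs vb] /andP[_ vd]].
  by have [] := outs v; rewrite ?inE // vb vd.
have cG : #|B| + #|D| + 4 = #|G|.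
  have -> : #|B| + #|D| = #|B :|: D| by rewrite cardsU BD cards0 subn0.
  have -> : 4 = #|s| by rewrite (card_uniqP us).
  rewrite addnC -(cardC (mem s)); congr (_ + _); apply: eq_card => v.
  rewrite !inE -andb_orr; apply: andb_idr => vs.
  by have [] := outs v; rewrite ?inE // => _ _ ->; case: adj.
split=> //.
have [vB vD] : (forall i : 'I_#|B|, enum_val i \notin s /\ adj (enum_val i) b)
    /\ (forall i : 'I_#|D|, enum_val i \notin s /\ adj (enum_val i) d).
  by split=> i; have := enum_valP i; rewrite in_set => /andP[].
pose h (x : G1 #|B| #|D|) : G := match x with
  | inl (inl i) => nth a s (i : 'I_4)
  | inl (inr i) => enum_val i
  | inr i => enum_val i
  end.
have adjs (i j : 'I_4) : adj (nth a s i) (nth a s j) = C4_adj i j.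
  move: cs; rewrite /= andbT => /and4P[ab bc cd da].
  case: i j => [[|[|[|[|//]]]] hi] [[|[|[|[|//]]]] hj] /=;
  by rewrite ?adj_irr ?ab ?bc ?cd ?da ?(negPf nac) ?(negPf nbd) // adj_sym ?ab ?bc ?cd ?da ?(negPf nac) ?(negPf nbd).
have adjB v (i : 'I_4) : v \notin s -> adj v b -> adj v (nth a s i) = (i == C4_v2).
  move=> /outs[/negPf na /negPf nc e] vb; move: e; rewrite vb => /esym/negPf nd.
  by case: i => [[|[|[|[|//]]]] hi].
have adjD v (i : 'I_4) : v \notin s -> adj v d -> adj v (nth a s i) = (i == C4_v4).
  move=> /outs[/negPf na /negPf nc e] vd; move: e; rewrite vd => /negPf nb.
  by case: i => [[|[|[|[|//]]]] hi].
apply: (isomorphic_inv (h := h)) => [|x y]; last first.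
  case: x y => [[i|i]|i] [[j|j]|j] /=.
  - exact: adjs.
  - by have [? ?] := vB j; rewrite adj_sym adjB.
  - by have [? ?] := vD j; rewrite adj_sym adjD.
  - by have [? ?] := vB i; rewrite adjB.
  - by have [? _] := vB i; have [? _] := vB j; apply: negPf; apply: indep.
  - by have [? _] := vB i; have [? _] := vD j; apply: negPf; apply: indep.
  - by have [? ?] := vD i; rewrite adjD.
  - by have [? _] := vD i; have [? _] := vB j; apply: negPf; apply: indep.
  - by have [? _] := vD i; have [? _] := vD j; apply: negPf; apply: indep.
apply: inj_card_bij; last by rewrite /= -cG !card_sum !card_ord; lia.
have outin v (i : 'I_4) : v \notin s -> v <> nth a s i.
  by move=> vs e; move: vs; rewrite e mem_nth.
have nBD (i : 'I_#|B|) (j : 'I_#|D|) : enum_val i <> enum_val j.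
  move=> e; have := in_set0 (enum_val i : G).
  by rewrite -BD inE enum_valP e enum_valP.
move=> [[i|i]|i] [[j|j]|j] /= e.
- congr (inl (inl _)); apply/val_inj/eqP; rewrite -(nth_uniq a _ _ us) ?ltn_ord //; exact/eqP.
- by have [/outin] := vB j => /(_ i)/nesym.
- by have [/outin] := vD j => /(_ i)/nesym.
- by have [/outin] := vB i => /(_ j).
- by rewrite (enum_val_inj e).
- by have := nBD i j.
- by have [/outin] := vD i => /(_ j).
- by have /nesym := nBD j i.
- by rewrite (enum_val_inj e).
Qed.

Lemma connected_neighbor (G : sgraph) (v w : G) :
  connected G -> v != w -> exists x, adj v x.
Proof.
move=> conn vw; have [||u [x [/= /eqP-> _ vx]]] := connected_boundary (A := pred1 v) (x := v) (y := w) conn.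
- by rewrite /= eqxx.
- by rewrite /= eq_sym.
by exists x.
Qed.

(** If more pendant vertices hang at [b] than at [d], rotating the cycle by two steps exchanges
    these roles. *)
Lemma C4_pendants_ordered (G : sgraph) (a b c d : G) :
  let s := [:: a; b; c; d] in
  ucycle (@adj G) s -> ~~ adj a c -> ~~ adj b d ->
  (forall v, v \notin s -> [/\ ~~ adj v a, ~~ adj v c & adj v b = ~~ adj v d]) ->
  {in [predC s] &, forall v w, ~~ adj v w} ->
  exists p q, [/\ p + q + 4 = #|G|, p <= q & isomorphic G (G1 p q)].
Proof.
move=> s us nac nbd outs indep.
have [iso sum] := C4_pendants_isomorphic us nac nbd outs indep.
have [le|/ltnW le] := leqP #|[set v in [predC s] | adj v b]| #|[set v in [predC s] | adj v d]|.
  by do 2!eexists; split; [exact: sum|exact: le|exact: iso].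
pose s' := [:: c; d; a; b].
have ss' v : (v \in s') = (v \in s) by rewrite (mem_rot 2 s).
have us' : ucycle (@adj G) s' by rewrite -[s']/(rot 2 s) rot_ucycle.
have [||v||iso' sum'] := C4_pendants_isomorphic us'.
- by rewrite adj_sym.
- by rewrite adj_sym.
- by rewrite ss' => /outs[-> -> ->]; rewrite negbK.
- by move=> v w vs ws; apply: indep; rewrite inE /= -ss'.
have eD e : #|[set v in [predC s'] | adj v e]| = #|[set v in [predC s] | adj v e]|.
  by apply: eq_card => v; rewrite !in_set; congr (~~ _ && _); exact: ss'.
rewrite /s' /= in eD; do 2!eexists; split; [exact: sum'|by rewrite !eD|exact: iso'].
Qed.

(** * Classification of unicyclic graphs with matching number 2 *)

Section SmallMatching.
Variable G : sgraph.
Hypotheses (uG : unicyclic G) (mG : matching_number G = 2).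

Let conn : connected G := proj1 uG.

Lemma no_three_disjoint_edges (a b c d e f : G) :
  adj a b -> adj c d -> adj e f -> uniq [:: a; b; c; d; e; f] -> False.
Proof.
by move=> ab cd ef /(three_disjoint_edges ab cd ef); rewrite mG.
Qed.

(** Serves to refute chords and outside vertices with two adjacent neighbours on the cycle. *)
Lemma triangle_eq_cycle (q : seq G) (x y z : G) : 2 < size q -> ucycle (@adj G) q ->
  adj x y -> adj y z -> adj z x -> q =i [:: x; y; z].
Proof.
move=> sq uq xy yz zx.
have ut : ucycle (@adj G) [:: x; y; z].
  by rewrite /ucycle /= xy yz zx !inE negb_or !adj_neq // adj_sym.
by move=> v; apply/idP/idP; apply: cycle_vertices_unique.
Qed.

Lemma C4_eq_cycle (q : seq G) (x y z t : G) : 2 < size q -> ucycle (@adj G) q ->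
  adj x y -> adj y z -> adj z t -> adj t x -> x != z -> y != t -> q =i [:: x; y; z; t].
Proof.
move=> sq uq xy yz zt tx xz yt.
have ut : ucycle (@adj G) [:: x; y; z; t].
  rewrite /ucycle /= xy yz zt tx !inE !negb_or xz yt !adj_neq //.
  by rewrite adj_sym.
by move=> v; apply/idP/idP; apply: cycle_vertices_unique.
Qed.

(** An edge off the cycle would extend two opposite cycle edges to three disjoint edges, and two
    cycle neighbours would create another cycle. So each outside vertex hangs at exactly one cycle
    vertex. *)
Lemma unicyclic_C4 (a b c d : G) : ucycle (@adj G) [:: a; b; c; d] ->
  exists p q, [/\ p + q + 4 = #|G|, p <= q & isomorphic G (G1 p q)].
Proof.
set s := [:: a; b; c; d] => us.
have /andP[/= /and5P[ab bc cd da _]] := us.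
rewrite !inE !negb_or !andbT => /and3P[/and3P[nab nac nad] /andP[nbc nbd] ncd].
have sE v : (v \in s) = [|| v == a, v == b, v == c | v == d] by rewrite !inE.
have nac' : ~~ adj a c.
  apply/negP; rewrite adj_sym => ca.
  have := triangle_eq_cycle (q := s) isT us ab bc ca d.
  by rewrite sE eqxx !orbT !inE !(eq_sym d) (negPf nad) (negPf nbd) (negPf ncd).
have nbd' : ~~ adj b d.
  apply/negP; rewrite adj_sym => db.
  have := triangle_eq_cycle (q := s) isT us bc cd db a.
  by rewrite sE eqxx !inE (negPf nab) (negPf nac) (negPf nad).
have adjacent v x y : v \notin s -> adj x y -> ~~ (adj v x && adj v y).
  move=> vs xy; apply: contra vs => /andP[vx vy]; rewrite adj_sym in vy.
  by rewrite (triangle_eq_cycle (x := v) (y := x) (z := y) _ us) // !inE eqxx.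
have opposite_ac v : v \notin s -> ~~ (adj v a && adj v c).
  move=> vs; have vb : v != b by apply: contra vs => /eqP->; rewrite sE eqxx orbT.
  apply: contra vs => /andP[va vc]; rewrite adj_sym in vc.
  by rewrite (C4_eq_cycle (x := v) (y := a) (z := b) (t := c) _ us) // !inE eqxx.
have opposite_bd v : v \notin s -> ~~ (adj v b && adj v d).
  move=> vs; have vc : v != c by apply: contra vs => /eqP->; rewrite sE eqxx !orbT.
  apply: contra vs => /andP[vb vd]; rewrite adj_sym in vd.
  by rewrite (C4_eq_cycle (x := v) (y := b) (z := c) (t := d) _ us) // !inE eqxx.
have indep : {in [predC s] &, forall v w, ~~ adj v w}.
  move=> v w; rewrite !inE !negb_or => /and4P[va vb vc vd] /and4P[wa wb wc wd].
  apply/negP => vw; have nvw := adj_neq vw.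
  by apply: (no_three_disjoint_edges ab cd vw); distinct.
have nbr v : v \notin s -> [|| adj v a, adj v b, adj v c | adj v d].
  move=> vs; have va : v != a by apply: contra vs => /eqP->; rewrite sE eqxx.
  have [x vx] := connected_neighbor conn va.
  have : x \in s by apply: contraLR vx => xs; apply: indep.
  by rewrite sE => /or4P[]/eqP <-; rewrite vx ?orbT.
(* Edges hanging at two consecutive cycle vertices are disjoint from the cycle edge joining the
   other two. *)
have clash v w : v \notin s -> w \notin s ->
    adj v a || adj v c -> adj w b || adj w d -> False.
  move=> vs ws va wb; have nvw : v != w.
    apply: contraTneq wb => <-; move: va.
    have := adjacent v _ _ vs ab; have := adjacent v _ _ vs bc.
    have := adjacent v _ _ vs cd; have := adjacent v _ _ vs da.
    by do 4!case: (adj v _).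
  have [va' vb' vc' vd'] : [/\ v != a, v != b, v != c & v != d].
    by move: vs; rewrite sE !negb_or => /and4P[].
  have [wa' wb' wc' wd'] : [/\ w != a, w != b, w != c & w != d].
    by move: ws; rewrite sE !negb_or => /and4P[].
  case/orP: va => va; case/orP: wb => wb.
  - by apply: (no_three_disjoint_edges va wb cd); distinct.
  - by apply: (no_three_disjoint_edges va wb bc); distinct.
  - by apply: (no_three_disjoint_edges va wb da); distinct.
  - by apply: (no_three_disjoint_edges va wb ab); distinct.
(* By [clash] all outside vertices hang at one opposite pair; if nothing hangs at [b] or [d], the
   cycle is rotated by one step. *)
have [/existsP[w /andP[ws wbd]]|no_bd] := boolP [exists w, (w \notin s) && (adj w b || adj w d)].
  apply: (C4_pendants_ordered us nac' nbd') => // v vs.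
  have [va|] := boolP (adj v a || adj v c); first by case: (clash v w vs ws va wbd).
  rewrite negb_or => /andP[va vc]; split => //.
  have := nbr v vs; have := opposite_bd v vs; rewrite (negPf va) (negPf vc) /=.
  by case: (adj v b); case: (adj v d).
have us' : ucycle (@adj G) [:: b; c; d; a] by rewrite -[[:: b; c; d; a]]/(rot 1 s) rot_ucycle.
have ss' v : (v \in [:: b; c; d; a]) = (v \in s) by rewrite (mem_rot 1 s).
apply: (C4_pendants_ordered us' nbd' _) => [|v|v w].
- by rewrite adj_sym.
- rewrite ss' => vs; move: no_bd; rewrite negb_exists => /forallP/(_ v).
  rewrite vs negb_or => /andP[vb vd]; split=> //.
  have := nbr v vs; have := opposite_ac v vs; rewrite (negPf vb) (negPf vd) /=.
  by case: (adj v a); case: (adj v c).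
- by move=> vs ws; apply: indep; rewrite inE /= -ss'.
Qed.

(** Let [y] be a neighbour of [v]. If [y] is on the triangle, then [vy], [uw] and the opposite side
    are disjoint; if [y] is neither there nor [u], then [vy], [ua] and [bc] are. *)
Lemma triangle_broom (a b c u w : G) : adj a b -> adj b c -> adj a c -> adj u a -> adj u w ->
  u \notin [:: a; b; c] -> w \notin [:: a; b; c] -> ~~ adj w a ->
  forall v, v \notin [:: u; a; b; c] -> adj v u.
Proof.
move=> ab bc ac ua uw; rewrite !inE !negb_or => /and3P[nua nub nuc] /and3P[nwa nwb nwc] wa v.
rewrite !inE !negb_or => /and4P[nvu nva nvb nvc].
have [->|nvw] := eqVneq v w; first by rewrite adj_sym.
have [nab nbc nac] : [/\ a != b, b != c & a != c] by rewrite !adj_neq.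
have nuw := adj_neq uw.
have [y vy] := connected_neighbor conn nva; have nvy := adj_neq vy.
have [eya|nya] := eqVneq y a.
  rewrite eya in vy; case: (no_three_disjoint_edges vy uw bc); distinct.
have [eyb|nyb] := eqVneq y b.
  rewrite eyb in vy; case: (no_three_disjoint_edges vy uw ac); distinct.
have [eyc|nyc] := eqVneq y c.
  rewrite eyc in vy; case: (no_three_disjoint_edges vy uw ab); distinct.
have [<-//|nyu] := eqVneq y u.
case: (no_three_disjoint_edges vy ua bc); distinct.
Qed.

(** Records the adjacencies that the radius bound uses, rather than an isomorphism type. *)
Definition pendant_triangle (a b c : G) : Prop :=
  [/\ adj a b, adj b c, adj a c & forall v, v \notin [:: a; b; c] -> adj v a || adj v b].

Definition broom_triangle (a b c u : G) : Prop :=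
  [/\ [/\ adj a b, adj b c & adj a c], adj u a, uniq [:: u; a; b; c]
    & forall v, v \notin [:: u; a; b; c] -> adj v u].

(** If every vertex is on the triangle or adjacent to it, some corner has no outside neighbour, for
    otherwise three disjoint edges hang there; that corner is taken as the third. Otherwise an edge
    [uw] leaves the closed neighbourhood of the triangle, and [u] is the centre of the broom. *)
Lemma unicyclic_C3 (a b c : G) : ucycle (@adj G) [:: a; b; c] ->
  (exists a b c, pendant_triangle a b c) \/ (exists a b c u, broom_triangle a b c u).
Proof.
set s := [:: a; b; c] => us.
have /andP[/= /and4P[ab bc ca _] _] := us.
have ac : adj a c by rewrite adj_sym.
have [ba cb] : adj b a /\ adj c b by rewrite !(adj_sym _ a) !(adj_sym c).
have sE v : (v \in s) = [|| v == a, v == b | v == c] by rewrite !inE.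
pose near v := (v \in s) || [|| adj v a, adj v b | adj v c].
have [/forallP all_near|/forallPn[w0 far0]] := boolP [forall v, near v].
  left.
  have outer v : v \notin s -> [|| adj v a, adj v b | adj v c].
    by move=> vs; have := all_near v; rewrite /near (negPf vs).
  have adjacent v x y : v \notin s -> adj x y -> ~~ (adj v x && adj v y).
    move=> vs xy; apply: contra vs => /andP[vx vy]; rewrite adj_sym in vy.
    by rewrite (triangle_eq_cycle (x := v) (y := x) (z := y) _ us) // !inE eqxx.
  have [/existsP[v /andP[vs va]]|no_a] := boolP [exists v, (v \notin s) && adj v a]; last first.
    exists b, c, a; split=> // v; rewrite -[[:: b; c; a]]/(rot 1 s) mem_rot => vs.
    have := outer v vs; move: no_a; rewrite negb_exists => /forallP/(_ v).
    by rewrite vs /= => /negPf->.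
  have [/existsP[w /andP[ws wb]]|no_b] := boolP [exists v, (v \notin s) && adj v b]; last first.
    exists c, a, b; split=> // w; rewrite -[[:: c; a; b]]/(rot 2 s) mem_rot => ws.
    have := outer w ws; move: no_b; rewrite negb_exists => /forallP/(_ w).
    by rewrite ws /= orbC => /negPf->.
  exists a, b, c; split=> // x xs.
  have := outer x xs; rewrite orbA => /orP[//|xc].
  have nvw : v != w by apply: contraTneq wb => <-; have := adjacent v _ _ vs ab; rewrite va.
  have nvx : v != x by apply: contraTneq xc => <-; have := adjacent v _ _ vs ac; rewrite va.
  have nwx : w != x by apply: contraTneq xc => <-; have := adjacent w _ _ ws bc; rewrite wb.
  move: vs ws xs; rewrite !sE !negb_or => /and3P[? ? ?] /and3P[? ? ?] /and3P[? ? ?].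
  have [? ? ?] : [/\ a != b, b != c & a != c] by rewrite !adj_neq.
  by case: (no_three_disjoint_edges va wb xc); distinct.
right.
have [||u [w [nu fw uw]]] := connected_boundary (A := near) (x := a) (y := w0) conn.
- by rewrite /near mem_head.
- exact: far0.
move: fw => /norP[ws]; rewrite !negb_or => /and3P[wa wb wc].
have us' : u \notin s.
  by apply: contraL uw; rewrite adj_sym sE => /or3P[]/eqP->.
have nus : uniq (u :: s) by rewrite cons_uniq us'; case/andP: us.
have broom x y z : adj x y -> adj y z -> adj x z -> perm_eq [:: x; y; z] s -> ~~ adj w x ->
    adj u x -> broom_triangle x y z u.
  move=> xy yz xz sxyz wx ux.
  have mem v : (v \in [:: x; y; z]) = (v \in s) by rewrite (perm_mem sxyz).
  split=> //; first by rewrite (perm_uniq (_ : perm_eq _ (u :: s))) // perm_cons.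
  by apply: triangle_broom xy yz xz ux uw _ _ wx; rewrite mem.
move: nu; rewrite /near (negPf us') /= => /or3P[ua|ub|uc].
- by exists a, b, c, u; apply: broom.
- by exists b, c, a, u; apply: broom => //; rewrite -[[:: b; c; a]]/(rot 1 s) perm_rot.
- by exists c, a, b, u; apply: broom => //; rewrite -[[:: c; a; b]]/(rot 2 s) perm_rot.
Qed.

Lemma unicyclic_matching2 : 5 < #|G| ->
  [\/ exists p q, [/\ p + q + 4 = #|G|, p <= q & isomorphic G (G1 p q)],
      exists a b c, pendant_triangle a b c | exists a b c u, broom_triangle a b c u].
Proof.
move=> G6; have [_ [C [[p [sp up _]] _]]] := uG.
case: p sp up => [//|a [//|b [//|c [|d [|e [|f p]]]]]] _ up.
- by have [] := unicyclic_C3 up; [constructor 2|constructor 3].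
- by constructor 1; apply: unicyclic_C4 up.
(* An edge [uw] leaves the 5-cycle, and the other four cycle vertices form a path containing two
   disjoint edges. *)
- exfalso; set s := [:: a; b; c; d; e] in up.
  have [v vs] : exists v, v \notin s.
    apply/existsP; rewrite -negb_forall; apply: contraTN G6 => /forallP all_s.
    rewrite -leqNgt; apply: leq_trans (card_size s).
    by apply: subset_leq_card; apply/subsetP => v _; exact: all_s.
  have [u [w [us ws uw]]] := connected_boundary (A := mem s) conn (mem_head a _) vs.
  move: up; rewrite /ucycle /= !inE !negb_or !andbT => /andP[/and5P[ab bc cd de ea]].
  move=> /and4P[/and4P[nab nac nad nae] /and3P[nbc nbd nbe] /andP[ncd nce] nde].
  move: ws; rewrite /= !inE !negb_or => /and5P[wa wb wc wd we].
  move: us; rewrite /= !inE => /or4P[/eqP e1|/eqP e1|/eqP e1|/orP[]/eqP e1]; rewrite e1 in uw.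
  - by apply: (no_three_disjoint_edges uw bc de); distinct.
  - by apply: (no_three_disjoint_edges uw cd ea); distinct.
  - by apply: (no_three_disjoint_edges uw de ab); distinct.
  - by apply: (no_three_disjoint_edges uw ea bc); distinct.
  - by apply: (no_three_disjoint_edges uw ab cd); distinct.
(* A cycle of length at least 6 contains three alternate edges. *)
exfalso; move: up => /andP[/= /and5P[ab _ cd _ /andP[ef _]] us].
apply: (no_three_disjoint_edges ab cd ef).
by have := take_uniq (s := [:: a, b, c, d, e, f & p]) 6 us; rewrite /= take0.
Qed.
End SmallMatching.

Theorem theorem2p1 (R : realType) (n : nat) (hn : 6 <= n) (G : sgraph)
    (hG : unicyclic_class n 2 G) :
  (spectral_radius R G >= spectral_radius R (G1 (n - 4)./2 (uphalf (n - 4))))%R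
  /\ (spectral_radius R G = spectral_radius R (G1 (n - 4)./2 (uphalf (n - 4)))
      <-> isomorphic G (G1 (n - 4)./2 (uphalf (n - 4)))).
Proof.
have [uG cG mG] := hG; set m := n - 4.
have m2 : 2 <= m by rewrite /m; lia.
have Gm : #|G| = m + 4 by rewrite cG /m; lia.
have iso_refl : isomorphic (G1 m./2 (uphalf m)) (G1 m./2 (uphalf m)).
  by exists id => //; exists id.
have rho1 := spectral_radius_G1 R iso_refl.
(* This dichotomy gives both the inequality and the equality case. *)
have : isomorphic G (G1 m./2 (uphalf m)) \/
    (spectral_radius R (G1 m./2 (uphalf m)) < spectral_radius R G)%R.
  rewrite rho1.
  have [|[p [q [pq le_pq iso]]]|[a [b [c [ab bc ac pend]]]]|] := unicyclic_matching2 uG mG.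
  - by rewrite cG.
  - have half_m : m./2 + uphalf m = p + q.
      by rewrite uphalf_half addnCA addnn odd_double_half; lia.
    have le_half : m./2 <= uphalf m by rewrite uphalf_half leq_addl.
    have [lt_p|ge_p] := ltnP p m./2.
      right; rewrite (spectral_radius_G1 R iso).
      exact: G1_radius_lt (esym half_m) le_pq le_half lt_p.
    have uphalf_le : uphalf m <= (m./2).+1 by rewrite uphalf_half; case: odd.
    have [-> ->] : m./2 = p /\ uphalf m = q by lia.
    by left.
  - by right; apply: triangle_pendants_radius Gm m2 ab bc ac pend.
  - move=> [a [b [c [u [[ab bc ac] ua us pend]]]]].
    by right; apply: triangle_broom_radius Gm m2 ab bc ac ua us pend.
case=> [iso|lt_rho].
  by rewrite rho1 (spectral_radius_G1 R iso) lexx.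
split; first exact: ltW.
split=> [eq_rho|iso]; first by rewrite eq_rho ltxx in lt_rho.
by rewrite rho1 (spectral_radius_G1 R iso).
Qed.
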